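(* Let $s\ge1$ and let $b_i,a_{ij}$ ($i,j=1,\dots,s$) be real Runge--Kutta coefficients. If the Runge--Kutta coefficient matrix $\mathbf{A}=(a_{ij})$ is positive semi-definite and the mobility operator $\mathcal{G}$ satisfies $\mathcal{G}=-\mathcal{B}^*\mathcal{B}$ for some linear operator $\mathcal{B}$ with adjoint $\mathcal{B}^*$, then the fully discrete scheme derived by applying the Fourier pseudo-spectral method in space to the $s$-stage LEQRK scheme is uniquely solvable; that is, for every $\Delta t>0$ and all given grid functions $\Phi^n,q^n$ and $\Phi_N(t_n+c_i\Delta t)$, $i=1,\dots,s$, the linear system for the stage values $(\Phi_i^n,Q_i^n,k_i^n,l_i^n)_{i=1}^s$ has exactly one solution (and hence $(\Phi^{n+1},q^{n+1})$ is uniquely determined).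
   Context: Conventions. A real, not necessarily symmetric, matrix $\mathbf{A}=(a_{ij})$ is positive semi-definite if $\sum_{i,j}a_{ij}x_ix_j\ge0$ for all real $x$. Model. $\Phi=(\phi_1,\dots,\phi_d)^T$ is a $d$-component state variable on a domain $\Omega$ with periodic boundary conditions. The gradient flow is $\partial_t\Phi=\mathcal{G}\,\frac{\delta F}{\delta\Phi}$ with $F=\frac12(\Phi,\mathcal{L}\Phi)+(f(\Phi,\nabla\Phi),1)$, where $\mathcal{L}$ is linear, self-adjoint, positive semi-definite and independent of $\Phi$ (written $\mathcal{L}=\mathcal{A}^*\mathcal{A}$ with $\mathcal{A}$ linear), and $f$ is bounded below. $C>0$ is a constant such that $f+C>0$, and $g[\Phi]=\sqrt{f(\Phi,\nabla\Phi)+C}$. $\frac{\partial g}{\partial\Phi}$ and $\frac{\partial g}{\partial\nabla\Phi}$ denote the partial derivatives of $g$ with respect to $\Phi$ and $\nabla\Phi$. The symbol $\cdot$ denotes full contraction over component (and derivative) indices, and $\nabla\cdot(2Q\frac{\partial g}{\partial\nabla\Phi})$ is the $d$-vector obtained by taking the divergence componentwise. Spatial discretization. Functions are replaced by real grid functions on a uniform periodic grid, products are pointwise, the inner product is the discrete one $(u,v)=|\text{cell}|\sum_{\text{grid points}}u\cdot v$, and $\nabla$, $\nabla\cdot$, $\mathcal{L}$, $\mathcal{G}$, $\mathcal{A}$, $\mathcal{B}$ denote (with the same symbols) the corresponding discrete Fourier pseudo-spectral operators, which are linear operators on grid functions. The discrete operators inherit the structure of the continuous ones: discrete integration by parts $(\nabla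 u,\mathbf v)=-(u,\nabla\cdot\mathbf v)$ holds, $\mathcal{L}=\mathcal{A}^*\mathcal{A}$, and $\mathcal{G}=-\mathcal{B}^*\mathcal{B}$, adjoints being with respect to the discrete inner product. $\mathcal{G}$ is a linear operator that does not depend on the unknown stage values. $s$-stage LEQRK scheme. Let $c_i=\sum_{j=1}^s a_{ij}$, $t_n=n\Delta t$. Given $(\Phi^n,q^n)$ and given (already known) values $\Phi_N(t_n+c_i\Delta t)$, put $$\Big(\tfrac{\partial g}{\partial\Phi}\Big)_i^{n,*}=\tfrac{\partial g}{\partial\Phi}[\Phi_N(t_n+c_i\Delta t)],\qquad \Big(\tfrac{\partial g}{\partial\nabla\Phi}\Big)_i^{n,*}=\tfrac{\partial g}{\partial\nabla\Phi}[\Phi_N(t_n+c_i\Delta t)].$$ The unknown stage values satisfy, for $i=1,\dots,s$, $$\Phi_i^n=\Phi^n+\Delta t\sum_{j=1}^s a_{ij}k_j^n,\qquad Q_i^n=q^n+\Delta t\sum_{j=1}^s a_{ij}l_j^n,$$ $$k_i^n=\mathcal{G}\Big(\mathcal{L}\Phi_i^n+2Q_i^n\Big(\tfrac{\partial g}{\partial\Phi}\Big)_i^{n,*}-\nabla\cdot\Big(2Q_i^n\Big(\tfrac{\partial g}{\partial\nabla\Phi}\Big)_i^{n,*}\Big)\Big),$$ $$l_i^n=\Big(\tfrac{\partial g}{\partial\Phi}\Big)_i^{n,*}\cdot k_i^n+\Big(\tfrac{\partial g}{\partial\nabla\Phi}\Big)_i^{n,*}\cdot\nabla k_i^n,$$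 and then $\Phi^{n+1}=\Phi^n+\Delta t\sum_{i=1}^s b_ik_i^n$, $q^{n+1}=q^n+\Delta t\sum_{i=1}^s b_il_i^n$. *)

(* Defs.v *)
From HB Require Import structures.
From mathcomp Require Import all_boot all_order all_algebra.
From mathcomp Require Import all_classical all_reals all_analysis.

Set Implicit Arguments.
Unset Strict Implicit.
Unset Printing Implicit Defensive.

Import Order.TTheory GRing.Theory Num.Theory.
Import numFieldNormedType.Exports.

Local Open Scope ring_scope.

(* The periodic box prod_a [0, ell a) is discretized by the uniform grid with
   N a points along axis a; x : grid N stands for the point with coordinates
   x a * ell a / N a. *)
Definition grid (D : nat) (N : 'I_D -> nat) : finType :=
  {dffun forall a : 'I_D, 'I_(N a)}.

Notation scalar_gf R N := {ffun grid N -> R}.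
Notation vector_gf R N d := {ffun grid N -> 'cV[R]_d}.
Notation tensor_gf R N m n := {ffun grid N -> 'M[R]_(m, n)}.

Definition contract (R : realType) (m n : nat) (u v : 'M[R]_(m, n)) : R :=
  \sum_(i < m) \sum_(j < n) u i j * v i j.

Section GridOperators.
Variables (R : realType) (D : nat) (ell : 'I_D -> R) (N : 'I_D -> nat).

Definition spacing (a : 'I_D) : R := ell a / (N a)%:R.

Definition inner (m n : nat) (u v : tensor_gf R N m n) : R :=
  (\prod_(a < D) spacing a) * \sum_(x : grid N) contract (u x) (v x).

Definition adjoint_operators (m p : nat)
    (T : vector_gf R N m -> vector_gf R N p)
    (Tstar : vector_gf R N p -> vector_gf R N m) : Prop :=
  forall u v, inner (T u) v = inner u (Tstar v).

(* Cardinal function of n-point trigonometric interpolation with period l,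
     (1/n) sum_(|k| <= n/2) (1/c_k) exp (2 pi i k z / l),
   where c_k = 2 if |k| = n/2 and c_k = 1 otherwise; the modes k and -k are
   grouped, which leaves cosines only. *)
Definition cardinal_fun (n : nat) (l : R) (z : R) : R :=
  n%:R^-1 * \sum_(0 <= k < n./2.+1)
    (if (k == 0)%N || (k.*2 == n)%N then 1 else 2)
      * cos (2 * pi * k%:R * z / l).

(* Fourier pseudo-spectral derivative: the trigonometric interpolant of u is
   differentiated along axis a and evaluated at the grid points. *)
Definition fourier_partial (a : 'I_D) (u : scalar_gf R N) : scalar_gf R N :=
  [ffun x : grid N => \sum_(y : grid N | [forall b, (b != a) ==> (y b == x b)])
     derive1 (cardinal_fun (N a) (ell a))
       (((x a)%:R - (y a)%:R) * spacing a) * u y].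

Definition grad (d : nat) (u : vector_gf R N d) : tensor_gf R N d D :=
  [ffun x => \matrix_(i < d, a < D)
     fourier_partial a [ffun y => u y i ord0] x].

Definition divergence (d : nat) (v : tensor_gf R N d D) : vector_gf R N d :=
  [ffun x => \col_(i < d)
     \sum_(a < D) fourier_partial a [ffun y => v y i a] x].

End GridOperators.

Section AuxiliaryVariable.
Variables (R : realType) (D d : nat) (ell : 'I_D -> R) (N : 'I_D -> nat).
Variables (f : 'cV[R]_d -> 'M[R]_(d, D) -> R) (C : R).

Definition gfun (phi : 'cV[R]_d) (p : 'M[R]_(d, D)) : R :=
  Num.sqrt (f phi p + C).

Definition dg_dphi (phi : 'cV[R]_d) (p : 'M[R]_(d, D)) : 'cV[R]_d :=
  \col_(i < d) derive1 (fun t : R => gfun (phi + t *: delta_mx i ord0) p) 0.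

Definition dg_dgrad (phi : 'cV[R]_d) (p : 'M[R]_(d, D)) : 'M[R]_(d, D) :=
  \matrix_(i < d, a < D)
    derive1 (fun t : R => gfun phi (p + t *: delta_mx i a)) 0.

Definition dg_dphi_at (Phi : vector_gf R N d) : vector_gf R N d :=
  [ffun x => dg_dphi (Phi x) (grad ell Phi x)].

Definition dg_dgrad_at (Phi : vector_gf R N d) : tensor_gf R N d D :=
  [ffun x => dg_dgrad (Phi x) (grad ell Phi x)].

End AuxiliaryVariable.

(* No symmetry is required. *)
Definition pos_semidef (R : realType) (s : nat) (A : 'M[R]_s) : Prop :=
  forall x : 'I_s -> R, 0 <= \sum_(i < s) \sum_(j < s) A i j * x i * x j.

Record stage_values (R : realType) (D : nat) (N : 'I_D -> nat) (d s : nat) :=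
  StageValues {
    st_Phi : {ffun 'I_s -> vector_gf R N d};
    st_Q : {ffun 'I_s -> scalar_gf R N};
    st_k : {ffun 'I_s -> vector_gf R N d};
    st_l : {ffun 'I_s -> scalar_gf R N} }.

Section LEQRK.
Variables (R : realType) (D : nat) (ell : 'I_D -> R) (N : 'I_D -> nat).
Variables (d s : nat) (A : 'M[R]_s) (b : 'I_s -> R).
Variables (L G : vector_gf R N d -> vector_gf R N d).
Variables (f : 'cV[R]_d -> 'M[R]_(d, D) -> R) (C : R).
Variables (dt : R) (n : nat) (PhiN : R -> vector_gf R N d).
Variables (Phin : vector_gf R N d) (qn : scalar_gf R N).

Definition rk_node (i : 'I_s) : R := \sum_(j < s) A i j.

Definition known_value (i : 'I_s) : vector_gf R N d :=
  PhiN (n%:R * dt + rk_node i * dt).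

Definition gphi (i : 'I_s) : vector_gf R N d :=
  dg_dphi_at ell f C (known_value i).

Definition ggrad (i : 'I_s) : tensor_gf R N d D :=
  dg_dgrad_at ell f C (known_value i).

Definition leqrk_stages (S : stage_values R N d s) : Prop :=
  forall i : 'I_s,
  [/\ st_Phi S i = Phin + dt *: \sum_(j < s) A i j *: st_k S j,
      forall x, st_Q S i x = qn x + dt * \sum_(j < s) A i j * st_l S j x,
      st_k S i = G (L (st_Phi S i)
                    + [ffun x => (2 * st_Q S i x) *: gphi i x]
                    - divergence ell
                        [ffun x => (2 * st_Q S i x) *: ggrad i x])
    & forall x, st_l S i x = contract (gphi i x) (st_k S i x)
                             + contract (ggrad i x) (grad ell (st_k S i) x)].

Definition next_Phi (S : stage_values R N d s) : vector_gf R N d :=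
  Phin + dt *: \sum_(i < s) b i *: st_k S i.

Definition next_q (S : stage_values R N d s) : scalar_gf R N :=
  [ffun x => qn x + dt * \sum_(i < s) b i * st_l S i x].

Definition leqrk_step (next : vector_gf R N d * scalar_gf R N) : Prop :=
  exists2 S, leqrk_stages S & next = (next_Phi S, next_q S).

End LEQRK.

(* Main.v *)
Require Import Defs.
From HB Require Import structures.
From mathcomp Require Import all_boot all_order all_algebra.
From mathcomp Require Import all_classical all_reals all_analysis.

(** The stage equations are affine in the unknowns, and [st_Phi], [st_Q] and
    [st_l] are explicit functions of the slopes [st_k]; eliminating them turns
    the system into a fixed-point equation [k = T k + c], with [T] linear on a
    finite-dimensional space and [c] collecting the data.  Such an equation
    has exactly one solution as soon as [T k = k] forces [k = 0]
    ([affine_fixpoint_unique]).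

    That last fact is an energy estimate for zero data.  Let mu_i be the
    discrete chemical potential at stage i, so that k_i = G mu_i, and compute
    E = sum_i (mu_i, k_i) in two ways.

    - Since G = - B^* B, E = - sum_i |B mu_i|^2 <= 0.

    - The way Q_i enters mu_i is twice the adjoint of the way k_i enters l_i,
      thanks to discrete integration by parts ([inner_coupling]).  With
      L = A^* A, writing A for the factor of L and a_ij for the coefficients,
      E = dt sum_ij a_ij (A k_j, A k_i) + 2 dt sum_ij a_ij (l_j, l_i), which is
      nonnegative because the coefficient matrix is positive semi-definite
      ([energy_production_ge0]).

    Hence every B mu_i vanishes, and k_i = - B^* B mu_i = 0
    ([homogeneous_stage_eq0]).

    Discrete integration by parts ([inner_grad]) holds because the spectral
    derivative is a convolution whose kernel, the derivative of an even
    function, is odd. *)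

Set Implicit Arguments.
Unset Strict Implicit.
Unset Printing Implicit Defensive.

Import Order.TTheory GRing.Theory Num.Theory.
Import numFieldNormedType.Exports.

Local Open Scope ring_scope.

(* Distinguishes the matrix contraction from the homonymous map that acts on
   extended reals. *)
Local Notation contract := Defs.contract.

(** * Affine fixed points in finite dimension *)

(** The hypothesis says that [id - T] is injective; an injective endomorphism
    of a finite-dimensional space is also surjective. *)
Lemma affine_fixpoint_unique (K : fieldType) (V : vectType K)
    (T : {linear V -> V}) (c : V) :
  (forall u, T u = u -> u = 0) -> exists! u, u = T u + c.
Proof.
move=> T_fix0; pose h : 'End(V) := (\1 - linfun T)%VF.
have hE u : h u = u - T u.
  by rewrite add_lfunE opp_lfunE id_lfunE lfunE.
have h_inj : injective h.
  move=> u v huv; apply/eqP; rewrite -subr_eq0; apply/eqP/T_fix0/esym/eqP.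
  by rewrite -subr_eq0 -hE linearB /= huv subrr.
have /memv_imgP[u _ cE] : c \in limg h.
  by rewrite lker0_limgf ?memvf//; exact/lker0P.
exists u; split=> [|v vE]; first by rewrite cE hE addrC subrK.
by apply: h_inj; rewrite -cE hE {1}vE addrC addKr.
Qed.

(** * The pseudo-spectral derivative kernel *)

Section SpectralDerivative.
Variable R : realType.

Lemma derivable_cardinal_fun n (l z : R) : derivable (cardinal_fun n l) z 1.
Proof.
rewrite /cardinal_fun.
under eq_fun do rewrite big_mkord.
apply: derivableM; first exact: derivable_cst.
pose c (k : 'I_n./2.+1) (y : R) : R :=
  (if (nat_of_ord k == 0)%N || (k.*2 == n)%N then 1 else 2)
      * cos (2 * pi * k%:R * y / l).
have -> : (fun y : R => \sum_(k < n./2.+1) c k y) = \sum_(k < n./2.+1) c k.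
  by apply/funext => y; rewrite fct_sumE.
apply: derivable_sum => k; apply: derivableM; first exact: derivable_cst.
apply/derivable1_diffP/differentiable_comp; last first.
  exact/derivable1_diffP/derivable_cos.
apply/derivable1_diffP.
apply: derivableM; last exact: derivable_cst.
apply: derivableM; first exact: derivable_cst.
exact: derivable_id.
Qed.

Lemma cardinal_funN n (l z : R) : cardinal_fun n l (- z) = cardinal_fun n l z.
Proof.
rewrite /cardinal_fun; congr (_ * _); apply: eq_bigr => k _.
by rewrite mulrN mulNr cosN.
Qed.

(** Differentiate [h (- y) = h y].  Derivability matters: [derive1] is a total
    limit operator, with no such symmetry where the limit does not exist. *)
Lemma derive1_even (h : R -> R) z :
  (forall y, derivable h y 1) -> (forall y, h (- y) = h y) ->
  derive1 h (- z) = - derive1 h z.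
Proof.
move=> dh h_even.
have -> : derive1 h z = derive1 (h \o -%R) z.
  by congr derive1; apply/funext => y /=.
rewrite (derive1_comp (f := -%R))//.
rewrite [derive1 -%R z]derive1E derive_val.
by rewrite mulrN1 opprK.
Qed.

End SpectralDerivative.

(** * The discrete inner product and integration by parts *)

Section Contract.
Variables (R : realType) (m p : nat).
Implicit Types u v w : 'M[R]_(m, p).

Lemma contractC u v : contract u v = contract v u.
Proof.
by apply: eq_bigr => i _; apply: eq_bigr => j _; rewrite mulrC.
Qed.

Lemma contract_linear_r u : linear_for *%R (contract u).
Proof.
move=> a v w; rewrite /contract mulr_sumr -big_split; apply: eq_bigr => i _.
rewrite mulr_sumr -big_split; apply: eq_bigr => j _.
by rewrite !mxE mulrDr mulrCA.
Qed.

HB.instance Definition _ u :=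
  GRing.isLinear.Build R 'M[R]_(m, p) R *%R (contract u)
    (contract_linear_r u).

Lemma contractZr a u v : contract u (a *: v) = a * contract u v.
Proof. exact: linearZ. Qed.

Lemma contract_ge0 u : 0 <= contract u u.
Proof. by do 2!apply: sumr_ge0 => ? _; rewrite -expr2 sqr_ge0. Qed.

Lemma contract_eq0 u : contract u u = 0 -> u = 0.
Proof.
move=> /eqP; rewrite psumr_eq0; last first.
  by move=> i _; apply: sumr_ge0 => j _; rewrite -expr2 sqr_ge0.
move=> /allP u0; apply/matrixP => i j; rewrite mxE; apply/eqP.
have := u0 i (mem_index_enum _); rewrite psumr_eq0; last first.
  by move=> k _; rewrite -expr2 sqr_ge0.
by move=> /allP/(_ j (mem_index_enum _)); rewrite -expr2 sqrf_eq0.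
Qed.

End Contract.

Section Inner.
Variables (R : realType) (D : nat) (ell : 'I_D -> R) (N : 'I_D -> nat).
Hypotheses (ell_gt0 : forall a, 0 < ell a) (N_gt0 : forall a, (0 < N a)%N).

Lemma cell_gt0 : 0 < \prod_(a < D) spacing ell N a.
Proof. by apply: prodr_gt0 => a _; rewrite divr_gt0 ?ltr0n. Qed.

Section Shape.
Variables m p : nat.
Implicit Types u v w : tensor_gf R N m p.

Lemma innerC u v : inner ell u v = inner ell v u.
Proof. by congr (_ * _); apply: eq_bigr => x _; rewrite contractC. Qed.

Lemma inner_linear_r u : linear_for *%R (inner ell u).
Proof.
move=> a v w; rewrite /inner mulrCA -mulrDr; congr (_ * _).
rewrite mulr_sumr -big_split; apply: eq_bigr => x _.
by rewrite !ffunE contract_linear_r.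
Qed.

HB.instance Definition _ u :=
  GRing.isLinear.Build R (tensor_gf R N m p) R *%R (inner ell u)
    (inner_linear_r u).

Lemma inner_ge0 u : 0 <= inner ell u u.
Proof.
by rewrite mulr_ge0 ?(ltW cell_gt0)// sumr_ge0// => x _; exact: contract_ge0.
Qed.

Lemma inner_eq0 u : inner ell u u = 0 -> u = 0.
Proof.
move=> /eqP; rewrite mulf_eq0 (gt_eqF cell_gt0) /= psumr_eq0; last first.
  by move=> x _; exact: contract_ge0.
move=> /allP u0; apply/ffunP => x; rewrite ffunE; apply/contract_eq0/eqP.
exact/(implyP (u0 x (mem_index_enum _))).
Qed.

End Shape.

(** The coefficient of [u y * v x] is the kernel at the displacement from [y]
    to [x]; exchanging the two grid points negates the displacement, and the
    kernel is odd. *)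
Lemma fourier_partial_antisym a (u v : scalar_gf R N) :
  \sum_x fourier_partial ell a u x * v x =
  - \sum_x u x * fourier_partial ell a v x.
Proof.
rewrite -sumrN.
under eq_bigr do rewrite ffunE mulr_suml big_mkcond.
rewrite exchange_big; apply: eq_bigr => y _ /=.
rewrite ffunE mulr_sumr -sumrN [RHS]big_mkcond; apply: eq_bigr => x _.
have -> : [forall b, (b != a) ==> (y b == x b)]
    = [forall b, (b != a) ==> (x b == y b)].
  by apply: eq_forallb => b; rewrite [y b == _]eq_sym.
case: ifP => // _.
rewrite -[in LHS]opprB mulNr derive1_even; last 2 first.
- by move=> z; exact: derivable_cardinal_fun.
- by move=> z; exact: cardinal_funN.
by rewrite !mulNr mulrAC mulrA [_ * u y]mulrC.
Qed.

Lemma fourier_partial_linear a t (u v : scalar_gf R N) (w : scalar_gf R N) :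
  (forall x, w x = t * u x + v x) -> forall x,
  fourier_partial ell a w x
  = t * fourier_partial ell a u x + fourier_partial ell a v x.
Proof.
move=> wE x; rewrite !ffunE mulr_sumr -big_split; apply: eq_bigr => y _.
by rewrite wE mulrDr mulrCA.
Qed.

Variable d : nat.

Lemma grad_linear : linear (@grad R D ell N d).
Proof.
move=> t u v; apply/ffunP => x; rewrite !ffunE; apply/matrixP => i a.
by rewrite !mxE; apply: fourier_partial_linear => y; rewrite !ffunE !mxE.
Qed.

HB.instance Definition _ :=
  GRing.isLinear.Build R (vector_gf R N d) (tensor_gf R N d D) *:%R
    (@grad R D ell N d) grad_linear.

Lemma divergence_linear : linear (@divergence R D ell N d).
Proof.
move=> t u v; apply/ffunP => x; rewrite !ffunE; apply/matrixP => i j.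
rewrite !mxE mulr_sumr -big_split; apply: eq_bigr => a _.
by apply: fourier_partial_linear => y; rewrite !ffunE !mxE.
Qed.

HB.instance Definition _ :=
  GRing.isLinear.Build R (tensor_gf R N d D) (vector_gf R N d) *:%R
    (@divergence R D ell N d) divergence_linear.

Lemma inner_grad (u : vector_gf R N d) (v : tensor_gf R N d D) :
  inner ell (grad ell u) v = - inner ell u (divergence ell v).
Proof.
rewrite /inner -mulrN; congr (_ * _).
rewrite exchange_big -sumrN.
under [RHS]eq_bigr do rewrite /contract -sumrN.
rewrite [RHS]exchange_big; apply: eq_bigr => i _ /=.
under [RHS]eq_bigr do rewrite big_ord1 ffunE mxE mulr_sumr -sumrN.
rewrite exchange_big [RHS]exchange_big; apply: eq_bigr => a _ /=.
pose ui : scalar_gf R N := [ffun x => u x i ord0].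
pose via : scalar_gf R N := [ffun x => v x i a].
have := fourier_partial_antisym a ui via.
rewrite -sumrN => E.
transitivity (\sum_x fourier_partial ell a ui x * via x).
  by apply: eq_bigr => x _; rewrite !ffunE mxE ffunE.
by rewrite E; apply: eq_bigr => x _; rewrite [ui x]ffunE.
Qed.

End Inner.

(** * Coupling between the state and the auxiliary variable *)

Section Coupling.
Variables (R : realType) (D : nat) (ell : 'I_D -> R) (N : 'I_D -> nat).
Variables (d : nat) (w : vector_gf R N d) (W : tensor_gf R N d D).

(** For the weights [w] and [W] given by the two partial derivatives of [g],
    this is the nonlinear part of the chemical potential, with its auxiliary
    variable [q]. *)
Definition coupling_force (q : scalar_gf R N) : vector_gf R N d :=
  [ffun x => (2 * q x) *: w x] - divergence ell [ffun x => (2 * q x) *: W x].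

(** The chain rule for g[Phi] when Phi moves with velocity [k]. *)
Definition coupling_rate (k : vector_gf R N d) : scalar_gf R N :=
  [ffun x => contract (w x) (k x) + contract (W x) (grad ell k x)].

Lemma coupling_force_linear a (q1 q2 q : scalar_gf R N) :
  (forall x, q x = a * q1 x + q2 x) ->
  coupling_force q = a *: coupling_force q1 + coupling_force q2.
Proof.
move=> qE; rewrite /coupling_force.
have scaleE n p (V : tensor_gf R N n p) :
    [ffun x => (2 * q x) *: V x]
    = a *: [ffun x => (2 * q1 x) *: V x] + [ffun x => (2 * q2 x) *: V x].
  by apply/ffunP => x; rewrite !ffunE qE mulrDr mulrCA scalerDl scalerA.
by rewrite !scaleE linearP scalerBr opprD addrACA.
Qed.

Lemma coupling_rate_linear a (k1 k2 : vector_gf R N d) x :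
  coupling_rate (a *: k1 + k2) x
  = a * coupling_rate k1 x + coupling_rate k2 x.
Proof.
by rewrite ffunE linearP !ffunE !contract_linear_r mulrDr addrACA.
Qed.

(** The duality behind energy stability: up to the factor 2, the force that
    [q] exerts on the state is the adjoint of the rate of change that the
    state induces on the auxiliary variable, so their energy exchanges match.
*)
Lemma inner_coupling (ell_gt0 : forall a, 0 < ell a)
    (N_gt0 : forall a, (0 < N a)%N) q (k : vector_gf R N d) :
  inner ell (coupling_force q) k
  = \prod_(a < D) spacing ell N a
    * (2 * \sum_x q x * coupling_rate k x).
Proof.
rewrite innerC linearB /= -[- inner _ _ _]inner_grad.
rewrite /inner -mulrDr -big_split; congr (_ * _).
rewrite mulr_sumr; apply: eq_bigr => x _.
rewrite /coupling_rate ffunE [in RHS]ffunE.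
rewrite (contractC (w x)) (contractC (W x)).
have scaleE n p (V : tensor_gf R N n p) :
    [ffun y => (2 * q y) *: V y] x = (2 * q x) *: V x by rewrite ffunE.
by rewrite !scaleE !contractZr /= -mulrDr mulrA.
Qed.

End Coupling.

(** * Positive semi-definite Runge-Kutta coefficients *)

Section PositiveSemidefinite.
Variables (R : realType) (s : nat) (A : 'M[R]_s).
Hypothesis A_psd : pos_semidef A.

Lemma pos_semidef_sum (x : 'I_s -> R) :
  0 <= \sum_i (\sum_j A i j * x j) * x i.
Proof.
apply: le_trans (A_psd x) _; rewrite le_eqVlt; apply/orP; left; apply/eqP.
apply: eq_bigr => i _; rewrite mulr_suml; apply: eq_bigr => j _.
by rewrite mulrAC.
Qed.

(** The inner product is a positive combination of products of entries, so the
    scalar inequality applies entry by entry. *)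
Lemma pos_semidef_inner (D : nat) (ell : 'I_D -> R) (N : 'I_D -> nat)
    (ell_gt0 : forall a, 0 < ell a) (N_gt0 : forall a, (0 < N a)%N)
    (m p : nat) (v : 'I_s -> tensor_gf R N m p) :
  0 <= \sum_i inner ell (\sum_j A i j *: v j) (v i).
Proof.
rewrite -mulr_sumr mulr_ge0 ?(ltW (cell_gt0 _ _))// exchange_big.
apply: sumr_ge0 => x _; rewrite exchange_big; apply: sumr_ge0 => i _.
rewrite exchange_big; apply: sumr_ge0 => j _ /=.
apply: le_trans (pos_semidef_sum (fun h => v h x i j)) _.
rewrite le_eqVlt; apply/orP; left; apply/eqP.
apply: eq_bigr => h _; congr (_ * _).
rewrite sum_ffunE summxE; apply: eq_bigr => h' _.
by rewrite ffunE mxE.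
Qed.

End PositiveSemidefinite.

(** [ffunE] alone would also unfold [u i] and [v i] when they are themselves
    given by comprehension. *)
Lemma ffun_combE (R : pzRingType) (I : finType) (V : lmodType R) a
    (u v : {ffun I -> V}) i :
  (a *: u + v) i = a *: u i + v i.
Proof. by rewrite !ffunE. Qed.

(** * The stage system reduced to the slopes *)

Section StageSystem.
Variables (R : realType) (D : nat) (ell : 'I_D -> R) (N : 'I_D -> nat).
Variables (d s : nat) (A : 'M[R]_s) (dt : R).
Variables (L G : {linear vector_gf R N d -> vector_gf R N d}).
Variables (w : 'I_s -> vector_gf R N d) (W : 'I_s -> tensor_gf R N d D).
Implicit Types (p : vector_gf R N d) (q : scalar_gf R N).
Implicit Types k : {ffun 'I_s -> vector_gf R N d}.

Definition stage_Phi p k (i : 'I_s) : vector_gf R N d :=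
  p + dt *: \sum_j A i j *: k j.

Definition stage_Q q k (i : 'I_s) : scalar_gf R N :=
  [ffun x => q x + dt * \sum_j A i j * coupling_rate ell (w j) (W j) (k j) x].

Definition stage_potential p q k (i : 'I_s) : vector_gf R N d :=
  L (stage_Phi p k i) + coupling_force ell (w i) (W i) (stage_Q q k i).

Definition stage_map p q k : {ffun 'I_s -> vector_gf R N d} :=
  [ffun i => G (stage_potential p q k i)].

Lemma stage_mapE p q k i : stage_map p q k i = G (stage_potential p q k i).
Proof. by rewrite /stage_map ffunE. Qed.

Lemma stage_Phi_linear a p1 p2 k1 k2 i :
  stage_Phi (a *: p1 + p2) (a *: k1 + k2) i
  = a *: stage_Phi p1 k1 i + stage_Phi p2 k2 i.
Proof.
rewrite /stage_Phi.
have -> : \sum_j A i j *: (a *: k1 + k2) j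
    = a *: (\sum_j A i j *: k1 j) + \sum_j A i j *: k2 j.
  rewrite scaler_sumr -big_split; apply: eq_bigr => j _ /=.
  by rewrite ffun_combE scalerDr !scalerA mulrC.
by rewrite !scalerDr addrACA !scalerA mulrC.
Qed.

Lemma stage_Q_linear a q1 q2 q k1 k2 i x :
  (forall y, q y = a * q1 y + q2 y) ->
  stage_Q q (a *: k1 + k2) i x = a * stage_Q q1 k1 i x + stage_Q q2 k2 i x.
Proof.
move=> qE; rewrite [LHS]ffunE [stage_Q q1 _ _ _]ffunE [stage_Q q2 _ _ _]ffunE.
rewrite qE mulrDr addrACA; congr (_ + _).
rewrite mulrCA -mulrDr; congr (_ * _).
rewrite mulr_sumr -big_split; apply: eq_bigr => j _ /=.
by rewrite ffun_combE coupling_rate_linear mulrDr mulrCA.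
Qed.

Lemma stage_potential_linear a p1 p2 q1 q2 q k1 k2 i :
  (forall x, q x = a * q1 x + q2 x) ->
  stage_potential (a *: p1 + p2) q (a *: k1 + k2) i
  = a *: stage_potential p1 q1 k1 i + stage_potential p2 q2 k2 i.
Proof.
move=> qE; rewrite /stage_potential stage_Phi_linear linearP.
have stage_QE x := stage_Q_linear k1 k2 i x qE.
rewrite (coupling_force_linear ell (w i) (W i) stage_QE).
by rewrite [in RHS]scalerDr addrACA.
Qed.

(** Joint linearity in data and slopes gives both the linearity of the
    homogeneous map and the splitting of [stage_map_affine]. *)
Lemma stage_map_linear a p1 p2 q1 q2 q k1 k2 :
  (forall x, q x = a * q1 x + q2 x) ->
  stage_map (a *: p1 + p2) q (a *: k1 + k2)
  = a *: stage_map p1 q1 k1 + stage_map p2 q2 k2.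
Proof.
move=> qE; apply/ffunP => i.
transitivity (a *: G (stage_potential p1 q1 k1 i)
              + G (stage_potential p2 q2 k2 i)).
  rewrite -linearP -(stage_potential_linear _ _ _ _ _ qE); exact: stage_mapE.
apply/esym/(etrans (ffun_combE _ _ _ _)); congr (_ *: _ + _).
  exact: stage_mapE.
exact: stage_mapE.
Qed.

Definition homogeneous_stage_map := stage_map 0 0.

Lemma homogeneous_stage_map_linear : linear homogeneous_stage_map.
Proof.
move=> a k1 k2; rewrite /homogeneous_stage_map.
have qE x : (0 : scalar_gf R N) x
    = a * (0 : scalar_gf R N) x + (0 : scalar_gf R N) x.
  by rewrite ffunE mulr0 addr0.
by have := stage_map_linear 0 0 k1 k2 qE; rewrite scaler0 addr0.
Qed.

HB.instance Definition _ :=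
  GRing.isLinear.Build R {ffun 'I_s -> vector_gf R N d}
    {ffun 'I_s -> vector_gf R N d} *:%R
    homogeneous_stage_map homogeneous_stage_map_linear.

Lemma stage_map_affine p q k :
  stage_map p q k = homogeneous_stage_map k + stage_map p q 0.
Proof.
have qE x : q x = 1 * (0 : scalar_gf R N) x + q x.
  by rewrite ffunE mulr0 add0r.
by have := stage_map_linear 0 p k 0 qE; rewrite !scale1r add0r addr0.
Qed.

(** * The energy estimate and unique solvability *)

Section Solvable.
Hypotheses (ell_gt0 : forall a, 0 < ell a) (N_gt0 : forall a, (0 < N a)%N).
Hypotheses (A_psd : pos_semidef A) (dt_gt0 : 0 < dt).
Hypothesis L_factor : exists (m : nat)
     (Aop : {linear vector_gf R N d -> vector_gf R N m})
     (Astar : {linear vector_gf R N m -> vector_gf R N d}),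
     adjoint_operators ell Aop Astar /\ (forall u, L u = Astar (Aop u)).
Hypothesis G_factor : exists (m : nat)
     (B : {linear vector_gf R N d -> vector_gf R N m})
     (Bstar : {linear vector_gf R N m -> vector_gf R N d}),
     adjoint_operators ell B Bstar /\ (forall u, G u = - Bstar (B u)).

(** Each of the two parts of the potential yields a quadratic form of the
    coefficient matrix: one in the images of the slopes under the factor of
    [L], the other in the slopes of the auxiliary variable. *)
Lemma energy_production_ge0 k :
  0 <= \sum_i inner ell (stage_potential 0 0 k i) (k i).
Proof.
have [m [Aop [Astar [AopP LE]]]] := L_factor.
under eq_bigr do rewrite innerC linearD /= ![inner _ (k _) _]innerC.
rewrite big_split addr_ge0//=.
  have E i : inner ell (L (stage_Phi 0 k i)) (k i)
      = dt * inner ell (\sum_j A i j *: Aop (k j)) (Aop (k i)).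
    rewrite LE innerC -AopP innerC /stage_Phi add0r linearZ linear_sum /=.
    rewrite innerC linearZ /= innerC; congr (_ * inner _ _ _).
    by apply: eq_bigr => j _; rewrite linearZ.
  under eq_bigr do rewrite E.
  by rewrite -mulr_sumr mulr_ge0 ?(ltW dt_gt0)// pos_semidef_inner.
under eq_bigr do rewrite inner_coupling//.
rewrite -mulr_sumr mulr_ge0 ?(ltW (cell_gt0 _ _))// -mulr_sumr mulr_ge0//.
rewrite exchange_big; apply: sumr_ge0 => x _ /=.
under eq_bigr do
  rewrite [stage_Q _ _ _ _]ffunE [(0 : scalar_gf R N) x]ffunE add0r -mulrA.
by rewrite -mulr_sumr mulr_ge0 ?(ltW dt_gt0)// pos_semidef_sum.
Qed.

(** Dissipation by [G] makes the energy production nonpositive; being also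
    nonnegative it vanishes, so no stage potential is seen by [B]. *)
Lemma homogeneous_stage_eq0 k : homogeneous_stage_map k = k -> k = 0.
Proof.
have [m [B [Bstar [BP GE]]]] := G_factor => kE.
pose mu := stage_potential 0 0 k.
have kiE i : k i = - Bstar (B (mu i)) by rewrite -{1}kE ffunE GE.
have dissipation i : inner ell (mu i) (k i) = - inner ell (B (mu i)) (B (mu i)).
  by rewrite kiE linearN /= -BP.
have := energy_production_ge0 k.
under eq_bigr do rewrite dissipation.
rewrite sumrN oppr_ge0 => le0.
have ge0 i : 0 <= inner ell (B (mu i)) (B (mu i)) by exact: inner_ge0.
have /eqP : \sum_i inner ell (B (mu i)) (B (mu i)) = 0.
  by apply/eqP; rewrite eq_le le0 sumr_ge0.
rewrite psumr_eq0// => /allP B0; apply/ffunP => i; rewrite ffunE kiE.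
have /eqP/inner_eq0 -> // := B0 i (mem_index_enum _).
by rewrite linear0 oppr0.
Qed.

Lemma stage_map_fixpoint_unique p q : exists! k, k = stage_map p q k.
Proof.
have [k [kE k_uniq]] := affine_fixpoint_unique (stage_map p q 0)
  homogeneous_stage_eq0.
exists k; split=> [|k']; first by rewrite stage_map_affine.
by rewrite stage_map_affine => /k_uniq.
Qed.

End Solvable.
End StageSystem.

Theorem theorem3p2 (R : realType)
  (* spatial grid *)
  (D : nat) (ell : 'I_D -> R) (N : 'I_D -> nat)
  (ell_gt0 : forall a, 0 < ell a) (N_gt0 : forall a, (0 < N a)%N)
  (* model *)
  (d : nat)
  (L : {linear vector_gf R N d -> vector_gf R N d})
  (L_factor : exists (m : nat)
     (Aop : {linear vector_gf R N d -> vector_gf R N m})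
     (Astar : {linear vector_gf R N m -> vector_gf R N d}),
     adjoint_operators ell Aop Astar /\ (forall u, L u = Astar (Aop u)))
  (f : 'cV[R]_d -> 'M[R]_(d, D) -> R) (C : R)
  (f_bounded_below : exists c : R, forall phi p, c <= f phi p)
  (C_gt0 : 0 < C) (fC_gt0 : forall phi p, 0 < f phi p + C)
  (G : {linear vector_gf R N d -> vector_gf R N d})
  (* Runge-Kutta coefficients *)
  (s : nat) (s_ge1 : (1 <= s)%N) (A : 'M[R]_s) (b : 'I_s -> R)
  (A_psd : pos_semidef A)
  (G_factor : exists (m : nat)
     (B : {linear vector_gf R N d -> vector_gf R N m})
     (Bstar : {linear vector_gf R N m -> vector_gf R N d}),
     adjoint_operators ell B Bstar /\ (forall u, G u = - Bstar (B u)))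
  (* data of the time step *)
  (dt : R) (dt_gt0 : 0 < dt) (n : nat)
  (PhiN : R -> vector_gf R N d)
  (Phin : vector_gf R N d) (qn : scalar_gf R N) :
  (exists! S : stage_values R N d s,
     leqrk_stages ell A L G f C dt n PhiN Phin qn S) /\
  (exists! next : vector_gf R N d * scalar_gf R N,
     leqrk_step ell A b L G f C dt n PhiN Phin qn next).
Proof.
pose w := gphi ell A f C dt n PhiN; pose W := ggrad ell A f C dt n PhiN.
pose F := stage_map ell A dt L G w W Phin qn.
pose stages k := StageValues [ffun i => stage_Phi A dt Phin k i]
  [ffun i => stage_Q ell A dt w W qn k i] k
  [ffun i => coupling_rate ell (w i) (W i) (k i)].
have stagesP S : leqrk_stages ell A L G f C dt n PhiN Phin qn S <->
    S = stages (st_k S) /\ st_k S = F (st_k S).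
  case: S => P Q k l; split=> /= [S_ok | [[-> -> ->] kE] i].
    have lE : l = [ffun i => coupling_rate ell (w i) (W i) (k i)].
      apply/ffunP => i; apply/ffunP => x; have [_ _ _ ->] := S_ok i.
      by rewrite [in RHS]ffunE [RHS]ffunE.
    have QE : Q = [ffun i => stage_Q ell A dt w W qn k i].
      apply/ffunP => i; apply/ffunP => x; have [_ -> _ _] := S_ok i.
      rewrite lE !ffunE; congr (_ + _ * _).
      by apply: eq_bigr => j _; rewrite ffunE.
    have PE : P = [ffun i => stage_Phi A dt Phin k i].
      by apply/ffunP => i; have [-> _ _ _] := S_ok i; rewrite ffunE.
    split; first by rewrite /stages PE QE lE.
    apply/ffunP => i; have [/= _ _ kE _] := S_ok i.
    have PiE : P i = stage_Phi A dt Phin k i by rewrite PE ffunE.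
    have QiE : Q i = stage_Q ell A dt w W qn k i by rewrite QE ffunE.
    by rewrite kE stage_mapE PiE QiE /stage_potential /coupling_force addrA.
  split=> /= [|x||x].
  - by rewrite ffunE.
  - rewrite [in LHS]ffunE [LHS]ffunE; congr (_ + _ * _).
    by apply: eq_bigr => j _; rewrite [in RHS]ffunE.
  - have PiE : [ffun i => stage_Phi A dt Phin k i] i = stage_Phi A dt Phin k i.
      by rewrite ffunE.
    have QiE : [ffun i => stage_Q ell A dt w W qn k i] i
        = stage_Q ell A dt w W qn k i by rewrite ffunE.
    rewrite PiE QiE -addrA; transitivity (F k i); first by rewrite -kE.
    exact: stage_mapE.
  - by rewrite [in LHS]ffunE [LHS]ffunE.
have [k [kE k_uniq]] : exists! k, k = F k by exact: stage_map_fixpoint_unique.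
have stages_ok : leqrk_stages ell A L G f C dt n PhiN Phin qn (stages k).
  exact/stagesP.
have stages_uniq S :
    leqrk_stages ell A L G f C dt n PhiN Phin qn S -> stages k = S.
  by move=> /stagesP[-> /k_uniq <-].
split; first by exists (stages k).
exists (next_Phi b dt Phin (stages k), next_q b dt qn (stages k)).
split; first by exists (stages k).
by move=> _ [S /stages_uniq <- ->].
Qed.
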